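(* Let $X$ be a normal space of covering dimension at most $4$. Let $n\geq1$ be an integer. Let $f:X\to M_n^{\mathrm{sa}}$ and $\epsilon:X\to\mathbb{R}_{>0}$ be continuous. Then there exists a continuous map $g:X\to M_n^{\mathrm{sa}}$ such that for all $x\in X$, $\|f(x)-g(x)\|<\epsilon(x)$ and $g(x)$ has at least $n-1$ distinct eigenvalues.
   Context: $M_n^{\mathrm{sa}}$ is the set of self-adjoint complex $n\times n$ matrices (with the operator norm). A topological space is normal if any two disjoint closed subsets have disjoint neighborhoods (no Hausdorff assumption). Covering dimension: a space $X$ has dimension at most $d$ if every open covering of $X$ has an open refinement $(V_j)_{j\in J}$ such that each $x\in X$ lies in $V_j$ for at most $d+1$ indices $j$. *)

(* Defs.v *)
From HB Require Import structures.
From mathcomp Require Export all_boot all_order all_algebra.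
From mathcomp Require Export all_classical all_reals all_analysis.
From mathcomp Require Export complex sesquilinear.
Export numFieldNormedType.Exports.

Set Implicit Arguments.
Unset Strict Implicit.
Unset Printing Implicit Defensive.

Import Order.TTheory GRing.Theory Num.Theory.

Local Open Scope classical_set_scope.
Local Open Scope ring_scope.
Local Open Scope complex_scope.

(* [numFieldNormedType] equips abstract numeric fields with the topology of
   their norm; [R[i]] is a concrete type and needs its own instances. *)
HB.instance Definition _ (R : realType) := GRing.ComAlgebra.copy R[i] R[i]^o.
HB.instance Definition _ (R : realType) := Vector.copy R[i] R[i]^o.
HB.instance Definition _ (R : realType) := NormedModule.copy R[i] R[i]^o.

Definition open_covering (X : topologicalType) (I : Type) (U : I -> set X) :=
  (forall i, open (U i)) /\ \bigcup_i U i = [set: X].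

Definition refines (X I J : Type) (V : J -> set X) (U : I -> set X) :=
  forall j, exists i, V j `<=` U i.

Definition covering_dim_le (X : topologicalType) (d : nat) :=
  forall (I : Type) (U : I -> set X), open_covering U ->
    exists (J : Type) (V : J -> set X),
      [/\ open_covering V, refines V U &
          forall x, ([set j | V j x] #<= `I_d.+1)%card].

(* The norms below are [R]-valued; the library norm [`|z|] of [z : R[i]] lives
   in [R[i]], and its matrix norm is the entrywise maximum.  The library topology
   on matrices is entrywise convergence, which is that of [op_norm] since the
   dimension is finite. *)
Definition vec_norm (R : realType) (n : nat) (v : 'cV[R[i]]_n) : R :=
  Num.sqrt (\sum_i Normc.normc (v i ord0) ^+ 2).

Definition op_norm (R : realType) (n : nat) (A : 'M[R[i]]_n) : R :=
  sup [set vec_norm (A *m v) | v in [set v | vec_norm v <= 1]].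

(* Main.v *)
(* The hermitian matrices with at most n - 2 distinct eigenvalues have a triple
   eigenvalue or two double ones, hence form a set of codimension 6.  A locally
   finite countable open cover of X on which f and eps are almost constant can be
   refined to one in which each point lies in at most 5 members; with a subordinate
   partition of unity p_i put g = sum_i p_i A_i, where A_i is close to the values of
   f on the i-th member.  Then g(x) has enough eigenvalues as soon as no A_i lies in
   the sum of the bad set and the span of four earlier A_j, a set of
   codimension at least 2.  That such a set can be avoided is proved without measure
   theory: it is a finite union of polynomial images of real vector spaces of
   smaller dimension, and counting monomials shows that each image meets a suitable
   monomial curve through any given point in finitely many parameters only. *)
Require Import Defs.
From mathcomp Require Import ring lra zify spectral.
Set Implicit Arguments.
Unset Strict Implicit.
Unset Printing Implicit Defensive.
Import Order.TTheory GRing.Theory Num.Theory.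

Local Open Scope classical_set_scope.
Local Open Scope sesquilinear_scope.
Local Open Scope ring_scope.
Local Open Scope complex_scope.

(** * Polynomial functions of real variables *)

Section PolynomialFunctions.
Variable R : realType.
Local Notation C := R[i].

(** The parameters are real and the values complex, so that conjugation preserves the class; complex
    parameters enter as pairs of real ones. *)
Inductive polyfun (I : Type) : ((I -> R) -> C) -> Prop :=
| polyfun_cst c : polyfun (fun=> c)
| polyfun_var i : polyfun (fun t => (t i)%:C)
| polyfunD f g : polyfun f -> polyfun g -> polyfun (fun t => f t + g t)
| polyfunM f g : polyfun f -> polyfun g -> polyfun (fun t => f t * g t).

Definition monom (I : finType) d (a : {ffun I -> 'I_d}) (t : I -> R) : C :=
  \prod_i (t i)%:C ^+ a i.

(* [d] bounds the degree in each variable separately. *)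
Definition polydeg (I : finType) d (f : (I -> R) -> C) :=
  exists c : {ffun I -> 'I_d.+1} -> C, forall t, f t = \sum_a c a * monom a t.

Lemma polydeg_cst (I : finType) d c : polydeg d (fun _ : I -> R => c).
Proof.
exists (fun a => if a == [ffun=> ord0] then c else 0) => t.
rewrite (bigD1 [ffun=> ord0]) //= eqxx big1 => [|a /negPf->]; last by rewrite mul0r.
by rewrite /monom big1 ?mulr1 ?addr0 // => i _; rewrite ffunE.
Qed.

Lemma polydegD (I : finType) d (f g : (I -> R) -> C) :
  polydeg d f -> polydeg d g -> polydeg d (fun t => f t + g t).
Proof.
move=> [c fE] [c' gE]; exists (fun a => c a + c' a) => t.
by rewrite fE gE -big_split; apply: eq_bigr => a _; rewrite mulrDl.
Qed.

Lemma polydegM (I : finType) d e (f g : (I -> R) -> C) :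
  polydeg d f -> polydeg e g -> polydeg (d + e) (fun t => f t * g t).
Proof.
move=> [c fE] [c' gE].
(* Exponents at most [d] and [e] add up to at most [d + e], so [inord] loses nothing. *)
pose add (p : {ffun I -> 'I_d.+1} * {ffun I -> 'I_e.+1}) :
  {ffun I -> 'I_(d + e).+1} := [ffun i => inord (p.1 i + p.2 i)].
exists (fun b => \sum_(p | add p == b) c p.1 * c' p.2) => t.
rewrite fE gE big_distrlr pair_big /= (partition_big add xpredT) //=.
apply: eq_bigr => b _; rewrite big_distrl; apply: eq_bigr => p /eqP <- /=.
suff -> : monom (add p) t = monom p.1 t * monom p.2 t by ring.
rewrite /monom -big_split; apply: eq_bigr => i _ /=.
rewrite ffunE inordK ?exprD //.
by move: (ltn_ord (p.1 i)) (ltn_ord (p.2 i)); lia.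
Qed.

Lemma polydeg_leq (I : finType) d e (f : (I -> R) -> C) :
  (d <= e)%N -> polydeg d f -> polydeg e f.
Proof.
move=> /subnKC <- /polydegM /(_ (polydeg_cst I (e - d) 1)) [c fE].
by exists c => t; rewrite -fE mulr1.
Qed.

Lemma polydegX (I : finType) d k (f : (I -> R) -> C) :
  polydeg d f -> polydeg (k * d) (fun t => f t ^+ k).
Proof.
move=> fd; elim: k => [|k IHk]; first by have := polydeg_cst I 0 1.
have [c fE] := polydegM fd IHk.
by exists c => t; rewrite -fE exprS.
Qed.

Lemma polydeg_prod (I J : finType) d (f : J -> (I -> R) -> C) :
  (forall j, polydeg d (f j)) -> polydeg (#|J| * d) (fun t => \prod_j f j t).
Proof.
move=> fd; rewrite cardE.
suff [c fE] : polydeg (size (enum J) * d) (fun t => \prod_(j <- enum J) f j t).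
  by exists c => t; rewrite -fE big_enum.
elim: (enum J) => [|j s IHs].
  have [c fE] := polydeg_cst I 0 1.
  by exists c => t; rewrite -fE big_nil.
have [c fE] := polydegM (fd j) IHs.
by exists c => t; rewrite -fE big_cons.
Qed.

Lemma polyfun_deg (I : finType) (f : (I -> R) -> C) :
  polyfun f -> exists d, polydeg d f.
Proof.
elim=> {f} [c|i|f g _ [d fd] _ [e ge]|f g _ [d fd] _ [e ge]].
- by exists 0; exact: polydeg_cst.
- exists 1, (fun a => if a == [ffun j => inord (j == i)] then 1 else 0) => t.
  rewrite (bigD1 [ffun j => inord (j == i)]) //= eqxx.
  rewrite [X in _ + X]big1 => [|a /negPf->]; last by rewrite mul0r.
  rewrite /monom (bigD1 i) //= big1 => [|j /negPf ji];
    rewrite ffunE inordK ?ltnS ?leq_b1 //.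
    by rewrite eqxx; ring.
  by rewrite ji.
- exists (maxn d e); apply: polydegD.
    by apply: polydeg_leq fd; exact: leq_maxl.
  by apply: polydeg_leq ge; exact: leq_maxr.
- by exists (d + e)%N; exact: polydegM.
Qed.

(** Splits off the lowest base-[M] digit. A single number [k] thus encodes an exponent vector with
    entries below [M]. *)
Lemma sum_digits M N k : (k < M ^ N)%N ->
  (\sum_(j < N) ((k %/ M ^ j) %% M) * M ^ j)%N = k.
Proof.
elim: N k => [|N IHN] k; first by rewrite big_ord0 ltnS leqn0 => /eqP.
rewrite expnS => kM; rewrite big_ord_recl expn0 divn1 muln1.
have M0 : (0 < M)%N by case: M kM {IHN}; lia.
rewrite [RHS](divn_eq k M) addnC; congr addn.
rewrite -[in RHS](IHN (k %/ M)%N); last by rewrite ltn_divLR // mulnC.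
rewrite big_distrl; apply: eq_bigr => j _ /=.
by rewrite /bump /= add1n expnS divnMA -mulnA (mulnC M).
Qed.

(* Counting monomials: those of degree [< M] in each of the [#|J|] target
   coordinates outnumber those available in the [#|I|] parameters, so the image
   satisfies a polynomial equation.  On the curve with coordinates
   [s ^ (M ^ j)], distinct such monomials restrict to distinct powers of [s]. *)
Lemma polyfun_image_thin (I J : finType) (P : (I -> R) -> J -> C) :
  (#|I| < #|J|)%N -> (forall j, polyfun (P^~ j)) ->
  exists M0, forall M, (M0 <= M)%N -> forall y0 : J -> C,
    exists2 q : {poly C}, q != 0 & forall s t,
      (forall j, P t j = y0 j + s ^+ (M ^ enum_rank j)) -> root q s.
Proof.
move=> IJ Ppol.
have [e Pe] : exists e, forall j, polydeg e (P^~ j).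
  have /choice[e Pe] : forall j, exists d, polydeg d (P^~ j).
    by move=> j; exact: polyfun_deg.
  exists (\max_j e j) => j; apply: polydeg_leq (Pe j); exact: leq_bigmax.
(* The threshold makes [((#|J| * e).+1 * M) ^ #|I|], a bound for the number of parameter monomials,
   smaller than [M ^ #|I|.+1], hence than [M ^ #|J|]. *)
exists ((#|J| * e).+1 ^ #|I|).+1 => M MM0 y0.
pose dig (k : 'I_(M ^ #|J|)) (j : J) := ((k %/ M ^ enum_rank j) %% M)%N.
pose g k t := \prod_j (P t j - y0 j) ^+ dig k j.
have gdeg k : polydeg (#|J| * (M.-1 * e)) (g k).
  apply: polydeg_prod => j; apply: (@polydeg_leq _ (dig k j * e)).
    by rewrite leq_mul2r; apply/orP; right; rewrite -ltnS prednK ?ltn_pmod //; lia.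
  by apply: polydegX; apply: polydegD => //; exact: polydeg_cst.
have /choice[c gE] := gdeg.
pose A := \matrix_(k < M ^ #|J|, a < #|{ffun I -> 'I_(#|J| * (M.-1 * e)).+1}|)
  c k (enum_val a).
have rA : (\rank A < M ^ #|J|)%N.
  apply: leq_ltn_trans (rank_leq_col _) _; rewrite card_ffun card_ord.
  apply: (@leq_ltn_trans (((#|J| * e).+1 * M) ^ #|I|)).
    have le_expn a b m : (a <= b)%N -> (a ^ m <= b ^ m)%N.
      by case: m => [|m] ab; rewrite ?expn0 ?leq_exp2r.
    apply: le_expn; have M_gt0 : (0 < M)%N by lia.
    by rewrite -ltnS -[in X in (_ < X)%N](prednK M_gt0); nia.
  rewrite expnMn; apply: (@leq_trans (M ^ #|I|.+1)); last first.
    by rewrite leq_pexp2l //; lia.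
  by rewrite expnS ltn_pmul2r // expn_gt0; apply/orP; left; lia.
(* A left kernel vector is a linear relation among the [g k]; its entries become the coefficients of
   the polynomial. *)
have /rowV0Pn[v /sub_kermxP vA v0] : kermx A != 0.
  by rewrite -mxrank_eq0 mxrank_ker; lia.
exists (\sum_(k < M ^ #|J|) v 0 k *: 'X^k).
  apply: contra_neq v0 => q0; apply/rowP => k; rewrite mxE.
  have := congr1 (coefp k) q0; rewrite /= coef0 coef_sum (bigD1 k) //=.
  rewrite coefZ coefXn eqxx mulr1 big1 ?addr0 // => l lk.
  by rewrite coefZ coefXn eq_sym (inj_eq val_inj) (negPf lk) mulr0.
move=> s t Pt; rewrite /root horner_sum.
have sE k : g k t = s ^+ k.
  rewrite -[in RHS](sum_digits (ltn_ord k)).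
  rewrite (reindex (@enum_rank J)) /=; last exact/onW_bij/enum_rank_bij.
  rewrite expr_sum; apply: eq_bigr => j _.
  by rewrite Pt addrC addKr -exprM mulnC.
apply/eqP; transitivity (\sum_a (v *m A) 0 a * monom (enum_val a) t); last first.
  by rewrite vA big1 // => a _; rewrite mxE mul0r.
under eq_bigr => k _ do rewrite hornerZ hornerXn -sE gE big_distrr /=.
rewrite exchange_big (reindex _ (onW_bij _ (@enum_val_bij _))) /=.
apply: eq_bigr => a _; rewrite mxE big_distrl; apply: eq_bigr => k _.
by rewrite mxE mulrA.
Qed.
End PolynomialFunctions.
Arguments polyfun_cst {R I} c.
Arguments polyfun_var {R I} i.

(** * Matrices with polynomial entries *)

Section PolynomialMatrices.
Variable R : realType.
Local Notation C := R[i].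

Lemma eq_polyfun (I : Type) (f g : (I -> R) -> C) :
  f =1 g -> polyfun f -> polyfun g.
Proof. by move=> /funext ->. Qed.

Lemma polyfunN (I : Type) (f : (I -> R) -> C) :
  polyfun f -> polyfun (fun t => - f t).
Proof.
move=> /(polyfunM (polyfun_cst (-1))); apply: eq_polyfun => t.
by rewrite mulN1r.
Qed.

Lemma polyfun_sum (I : Type) (J : Type) (s : seq J) (f : J -> (I -> R) -> C) :
  (forall j, polyfun (f j)) -> polyfun (fun t => \sum_(j <- s) f j t).
Proof.
move=> fP; elim: s => [|j s IHs].
  by apply: eq_polyfun (polyfun_cst 0) => t; rewrite big_nil.
by apply: eq_polyfun (polyfunD (fP j) IHs) => t; rewrite big_cons.
Qed.

Lemma polyfun_prod (I : Type) (J : Type) (s : seq J) (f : J -> (I -> R) -> C) :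
  (forall j, polyfun (f j)) -> polyfun (fun t => \prod_(j <- s) f j t).
Proof.
move=> fP; elim: s => [|j s IHs].
  by apply: eq_polyfun (polyfun_cst 1) => t; rewrite big_nil.
by apply: eq_polyfun (polyfunM (fP j) IHs) => t; rewrite big_cons.
Qed.

Lemma polyfun_conj (I : Type) (f : (I -> R) -> C) :
  polyfun f -> polyfun (fun t => (f t)^*).
Proof.
elim=> {f} [c|i|f g _ fP _ gP|f g _ fP _ gP].
- exact: polyfun_cst.
- by apply: eq_polyfun (polyfun_var i) => t; rewrite conjc_real.
- by apply: eq_polyfun (polyfunD fP gP) => t; rewrite rmorphD.
- by apply: eq_polyfun (polyfunM fP gP) => t; rewrite rmorphM.
Qed.

Lemma polyfun_comp (I J : Type) (h : J -> I) (f : (J -> R) -> C) :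
  polyfun f -> polyfun (fun t : I -> R => f (t \o h)).
Proof.
elim=> {f} [c|i|f g _ fP _ gP|f g _ fP _ gP].
- exact: polyfun_cst.
- exact: polyfun_var.
- exact: polyfunD.
- exact: polyfunM.
Qed.

Definition polymx (I : Type) m n (F : (I -> R) -> 'M[C]_(m, n)) :=
  forall i j, polyfun (fun t => F t i j).

Lemma polymx_cst (I : Type) m n (A : 'M[C]_(m, n)) :
  polymx (fun _ : I -> R => A).
Proof. by move=> i j; exact: polyfun_cst. Qed.

Lemma polymxD (I : Type) m n (F G : (I -> R) -> 'M[C]_(m, n)) :
  polymx F -> polymx G -> polymx (fun t => F t + G t).
Proof.
move=> FP GP i j; apply: eq_polyfun (polyfunD (FP i j) (GP i j)) => t.
by rewrite mxE.
Qed.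

Lemma polymxZ (I : Type) m n f (F : (I -> R) -> 'M[C]_(m, n)) :
  polyfun f -> polymx F -> polymx (fun t => f t *: F t).
Proof.
move=> fP FP i j; apply: eq_polyfun (polyfunM fP (FP i j)) => t.
by rewrite mxE.
Qed.

Lemma polymxM (I : Type) m n p (F : (I -> R) -> 'M[C]_(m, n))
    (G : (I -> R) -> 'M[C]_(n, p)) :
  polymx F -> polymx G -> polymx (fun t => F t *m G t).
Proof.
move=> FP GP i j.
apply: eq_polyfun (polyfun_sum _ (fun k => polyfunM (FP i k) (GP k j))) => t.
by rewrite mxE.
Qed.

Lemma polymx_sum (I J : Type) (s : seq J) m n (F : J -> (I -> R) -> 'M[C]_(m, n)) :
  (forall j, polymx (F j)) -> polymx (fun t => \sum_(j <- s) F j t).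
Proof.
move=> FP i j; apply: eq_polyfun (polyfun_sum _ (fun k => FP k i j)) => t.
by rewrite summxE.
Qed.

Lemma polymx_conj (I : Type) m n (F : (I -> R) -> 'M[C]_(m, n)) :
  polymx F -> polymx (fun t => (F t)^t*).
Proof.
by move=> FP i j; apply: eq_polyfun (polyfun_conj (FP j i)) => t; rewrite !mxE.
Qed.

Lemma polymx_comp (I J : Type) (h : J -> I) m n (F : (J -> R) -> 'M[C]_(m, n)) :
  polymx F -> polymx (fun t : I -> R => F (t \o h)).
Proof. by move=> FP i j; exact: polyfun_comp (FP i j). Qed.

Lemma polyfun_det (I : Type) n (F : (I -> R) -> 'M[C]_n) :
  polymx F -> polyfun (fun t => \det (F t)).
Proof.
move=> FP; apply: polyfun_sum => s.
apply: polyfunM (polyfun_cst _) _.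
by apply: polyfun_prod => i; exact: FP.
Qed.

Lemma polymx_adj (I : Type) n (F : (I -> R) -> 'M[C]_n) :
  polymx F -> polymx (fun t => \adj (F t)).
Proof.
move=> FP i j.
apply: eq_polyfun (polyfunM (polyfun_cst ((-1) ^+ (j + i)))
  (polyfun_det (F := fun t => row' j (col' i (F t))) _)).
  by move=> t; rewrite mxE.
by move=> k l; apply: eq_polyfun (FP (lift j k) (lift i l)) => t; rewrite !mxE.
Qed.

End PolynomialMatrices.

(** * Hermitian matrices and their real coordinates *)

Section Hermitian.
Variable R : realType.
Local Notation C := R[i].

Lemma hermP n (A : 'M[C]_n) : reflect (A^t* = A) (A \is hermsymmx).
Proof.
by rewrite is_hermitianmxE expr0 scale1r eq_sym; exact: eqP.
Qed.

Lemma conj_mxM m n p (A : 'M[C]_(m, n)) (B : 'M[C]_(n, p)) :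
  (A *m B)^t* = B^t* *m A^t*.
Proof. by rewrite trmx_mul map_mxM. Qed.

Lemma conj_mxD m n (A B : 'M[C]_(m, n)) : (A + B)^t* = A^t* + B^t*.
Proof. by rewrite linearD map_mxD. Qed.

Lemma conj_mxB m n (A B : 'M[C]_(m, n)) : (A - B)^t* = A^t* - B^t*.
Proof. by rewrite linearB map_mxB. Qed.

Lemma conj_mxZ m n (a : R) (A : 'M[C]_(m, n)) : (a%:C *: A)^t* = a%:C *: A^t*.
Proof. by rewrite linearZ map_mxZ /=; congr (_ *: _); exact: conjc_real. Qed.

Lemma conj_scalar_mx n (a : R) : (a%:C%:M : 'M[C]_n)^t* = a%:C%:M.
Proof. by rewrite tr_scalar_mx map_scalar_mx; congr _%:M; exact: conjc_real. Qed.

Lemma conj_mxK m n (A : 'M[C]_(m, n)) : A^t*^t* = A.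
Proof. exact: trmxCK. Qed.

Lemma conjc_id (z : C) : z^* = z -> z = (complex.Re z)%:C.
Proof. by move=> zz; rewrite ReJ_add zz; field. Qed.

Lemma herm_det n (A : 'M[C]_n) : A^t* = A -> (\det A)^* = \det A.
Proof. by move=> AA; rewrite -[in RHS]AA det_map_mx det_tr. Qed.

(** The diagonal entries of [A *m A^t*] are sums of squared moduli. *)
Lemma mulmx_conj_eq0 m n (A : 'M[C]_(m, n)) : A *m A^t* = 0 -> A = 0.
Proof.
move=> A0; apply/matrixP => i j; rewrite mxE.
have /matrixP/(_ i i) := A0; rewrite !mxE.
under eq_bigr => k _ do rewrite !mxE -normCK.
move=> /eqP; rewrite psumr_eq0 => [/allP/(_ j)|k _]; last exact: exprn_ge0.
by rewrite mem_index_enum => /(_ isT); rewrite sqrf_eq0 normr_eq0 => /eqP.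
Qed.

(** If [K] kills [M *m M^t*], then [mulmx_conj_eq0] applied to [K *m M] gives [K *m M = 0]. *)
Lemma gram_unit m n (M : 'M[C]_(m, n)) : row_free M -> M *m M^t* \in unitmx.
Proof.
move=> Mf; rewrite -row_free_unit -kermx_eq0; apply/eqP.
set K := kermx _; have : K *m M = 0.
  apply: mulmx_conj_eq0; rewrite conj_mxM mulmxA -(mulmxA K) mulmx_ker.
  by rewrite mul0mx.
by rewrite -(mul0mx _ M); exact: row_free_inj.
Qed.

(* An [R]-linear bijection from real matrices onto hermitian ones, with inverse
   [A |-> Re A + Im A]; both are extended [C]-linearly. *)
Definition herm_of n (Y : 'M[C]_n) : 'M[C]_n :=
  2^-1 *: (Y + Y^T) + ('i / 2) *: (Y - Y^T).

Definition coord_of n (A : 'M[C]_n) : 'M[C]_n :=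
  2^-1 *: (A + A^T) - ('i / 2) *: (A - A^T).

Lemma coord_ofK n (A : 'M[C]_n) : herm_of (coord_of A) = A.
Proof.
apply/matrixP => i j; rewrite !mxE.
have := sqrCi C; set I := Num.imaginary => I2.
by field: I2.
Qed.

Lemma herm_ofK n (Y : 'M[C]_n) : coord_of (herm_of Y) = Y.
Proof.
apply/matrixP => i j; rewrite !mxE.
have := sqrCi C; set I := Num.imaginary => I2.
by field: I2.
Qed.

Lemma coord_of_real n (A : 'M[C]_n) i j : A^t* = A ->
  (coord_of A i j)^* = coord_of A i j.
Proof.
move=> /matrixP AA; have := AA i j; have := AA j i; rewrite !mxE => Aij Aji.
rewrite -[conjc]/Num.conj in Aij Aji *.
rewrite !(rmorphD, rmorphN, rmorphM, fmorphV) /= conjCi Aij Aji.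
by rewrite rmorph1; field.
Qed.

Lemma herm_of_herm n (Y : 'M[C]_n) : (forall i j, (Y i j)^* = Y i j) ->
  (herm_of Y)^t* = herm_of Y.
Proof.
move=> YY; apply/matrixP => i j; rewrite !mxE.
have := YY i j; have := YY j i; rewrite -[conjc]/Num.conj => Yij Yji.
rewrite !(rmorphD, rmorphN, rmorphM, fmorphV) /= conjCi Yij Yji.
by rewrite rmorph1; field.
Qed.
End Hermitian.

(** * Hermitian matrices of low rank *)

Section LowRank.
Variable R : realType.
Local Notation C := R[i].

(* When [f] and [g] enumerate complementary sets of columns, the columns in [f]
   form the identity and those in [g] form [Q]. *)
Definition frame a r (f : 'I_r -> 'I_(a + r)) (g : 'I_a -> 'I_(a + r))
  (Q : 'M[C]_(r, a)) : 'M[C]_(r, a + r) := rowsub f 1%:M + Q *m rowsub g 1%:M.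

(** Some [r] columns of [B] form an invertible [S]; passing to [invmx S *m B] turns them into the
    identity and keeps the row space. *)
Lemma row_free_frame a r (B : 'M[C]_(r, a + r)) : row_free B ->
  exists f : {ffun 'I_r -> 'I_(a + r)}, exists g : {ffun 'I_a -> 'I_(a + r)},
  exists Q, row_free (frame f g Q) /\ (B <= frame f g Q)%MS.
Proof.
move=> Bfree.
have BTfull : row_full B^T by rewrite /row_full mxrank_tr.
pose f : {ffun 'I_r -> 'I_(a + r)} := fullrankfun BTfull.
have f_inj : injective f by exact: fullrankfun_inj.
pose S := colsub f B.
have S_unit : S \in unitmx.
  rewrite -unitmx_tr -row_full_unit.
  suff -> : S^T = rowsub (fullrankfun BTfull) B^T by exact: fullrowsub_full.
  by apply/matrixP => i j; rewrite !mxE.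
have cardf : #|~: (f @: 'I_r)| = a.
  by rewrite cardsCs finset.setCK card_imset // !card_ord addnK.
pose g := [ffun i : 'I_a => enum_val (cast_ord (esym cardf) i)].
have gf i j : g i != f j.
  have := enum_valP (cast_ord (esym cardf) i); rewrite inE.
  by apply: contraNneq; rewrite ffunE => ->; apply: imset_f.
have g_inj : injective g.
  by move=> i j; rewrite !ffunE => /enum_val_inj /cast_ord_inj.
pose M := invmx S *m B.
have Mf i i' : M i (f i') = (i == i')%:R.
  have : colsub f M = 1%:M by rewrite -mulmx_colsub mulVmx.
  by move/matrixP/(_ i i'); rewrite !mxE.
have BM : B = S *m M by rewrite mulKVmx.
have Mfree : row_free M.
  by rewrite /row_free eqmxMfull ?row_full_unit ?unitmx_inv.
clearbody M; have ME : M = frame f g (colsub g M).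
  apply/matrixP => i j; rewrite !mxE.
  under eq_bigr => b _ do rewrite !mxE.
  have [/imsetP[i' _ ->]|jf] := boolP (j \in f @: 'I_r).
    rewrite Mf (inj_eq f_inj) big1 ?addr0 // => b _.
    by rewrite (negPf (gf _ _)) mulr0.
  have [b ->] : exists b, j = g b.
    have jC : j \in ~: (f @: 'I_r) by rewrite inE.
    exists (cast_ord cardf (enum_rank_in jC j)).
    by rewrite ffunE cast_ord_comp cast_ord_id enum_rankK_in.
  rewrite eq_sym (negPf (gf _ _)) add0r (bigD1 b) //= eqxx mulr1.
  rewrite big1 ?addr0 ?mxE // => b' /negPf b'b.
  by rewrite (inj_eq g_inj) b'b mulr0.
exists f, g, (colsub g M); rewrite -ME; split=> //.
by rewrite BM submxMl.
Qed.

(** The rows of [B] are the first [r] rows of the invertible matrix [row_ebase H]. *)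
Lemma lowrank_sub_free a r (H : 'M[C]_(a + r)) : (\rank H <= r)%N ->
  exists2 B : 'M[C]_(r, a + r), row_free B & (H <= B)%MS.
Proof.
move=> Hr; exists ((pid_mx r : 'M[C]_(r, a + r)) *m row_ebase H).
  by rewrite /row_free mxrankMfree ?row_free_unit ?row_ebase_unit //
    rank_pid_mx // leq_addl.
rewrite -{1}(mulmx_ebase H).
have -> : pid_mx (\rank H) = (pid_mx (\rank H) : 'M[C]_(a + r, r)) *m
    (pid_mx r : 'M[C]_(r, a + r)).
  by rewrite mul_pid_mx; congr pid_mx; lia.
by rewrite !mulmxA -mulmxA submxMl.
Qed.

(** Write [H = X *m M] with [M] a frame and [N] a right inverse of [M]. Then [H *m N *m M = H], and
    by symmetry [M^t* *m N^t* *m H = H], so [P = N^t* *m H *m N] works. The pair [Q], [P] has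
    [2 * a * r + r ^ 2] real parameters, whence codimension [a ^ 2]. *)
Lemma herm_lowrank a r (H : 'M[C]_(a + r)) : H^t* = H -> (\rank H <= r)%N ->
  exists f : {ffun 'I_r -> 'I_(a + r)}, exists g : {ffun 'I_a -> 'I_(a + r)},
  exists Q, exists P, [/\ row_free (frame f g Q), P^t* = P &
    H = (frame f g Q)^t* *m P *m frame f g Q].
Proof.
move=> HH /lowrank_sub_free[B /row_free_frame[f [g [Q [Mf BM]]]] HB].
exists f, g, Q; set M := frame f g Q in Mf BM *.
have /submxP[X HX] := submx_trans HB BM.
have [N MN] : exists N, M *m N = 1%:M by apply/row_freeP.
exists (N^t* *m H *m N); split=> //.
  by rewrite !conj_mxM HH conj_mxK mulmxA.
have HNM : H *m N *m M = H by rewrite {1}HX -(mulmxA X) MN mulmx1.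
have MNH : M^t* *m N^t* *m H = H.
  by rewrite -conj_mxM -[in LHS]HH -conj_mxM mulmxA HNM HH.
by rewrite -!mulmxA (mulmxA H) HNM mulmxA MNH.
Qed.

Lemma rank_diag_mx n (d : 'rV[C]_n) :
  (\rank (diag_mx d) <= #|[pred i | d ord0 i != 0%R]|)%N.
Proof.
rewrite diag_mx_sum_delta -sum1_card [leqRHS]big_mkcond /=.
elim/big_rec2: _ => [|i k B _ IH]; first by rewrite mxrank0.
apply: leq_trans (mxrank_add _ _) (leq_add _ IH).
rewrite inE; case: eqVneq => [->|_]; first by rewrite scale0r mxrank0.
by apply: leq_trans (mxrank_scale _ _) _; rewrite mxrank_delta.
Qed.

Definition almost_simple n (A : 'M[C]_n) := exists s : seq C,
  [/\ uniq s, (n - 1 <= size s)%N & all (eigenvalue A) s].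

(** For hermitian [A] and [n >= 3] the rank condition means that [lam] has multiplicity at least 3;
    eigenvalues are real, so [lam] ranges over [R]. The set [two_pairs] is read in the same way,
    with multiplicity 2. *)
Definition triple n : set 'M[C]_n := [set A | A^t* = A /\
  exists lam : R, (\rank (A - lam%:C%:M)%R <= n - 3)%N].
Definition two_pairs n : set 'M[C]_n := [set A | A^t* = A /\
  exists lam mu : R, [/\ lam != mu, (\rank (A - lam%:C%:M)%R <= n - 2)%N &
    (\rank (A - mu%:C%:M)%R <= n - 2)%N]].

Arguments triple : clear implicits.
Arguments two_pairs : clear implicits.

(** After diagonalization, any [n - 1] of the indices contain two with equal eigenvalue. This is
    used twice, the second time without [i]: the new pair [k], [l] makes a triple with [i] or has a
    different eigenvalue. *)
Lemma not_almost_simple n (A : 'M[C]_n) : A^t* = A -> ~ almost_simple A ->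
  (triple n `|` two_pairs n) A.
Proof.
move=> AA Abad; have /hermP Aherm := AA.
have /orthomx_spectralP AE := hermitian_normalmx Aherm.
have Pu := spectral_unit A.
have spR := hermitian_spectral_diag_real Aherm.
set P := spectralmx A in AE Pu; set sp := spectral_diag A in AE spR.
pose v i := sp 0 i.
have vR i : v i = (complex.Re (v i))%:C.
  by apply: conjc_id; apply/CrealP; move/mxOverP: spR; apply.
have subE lam : A - lam%:M = invmx P *m diag_mx (sp - const_mx lam) *m P.
  rewrite linearB /= diag_const_mx mulmxBr mulmxBl -AE; congr (_ - _).
  by rewrite mul_mx_scalar -scalemxAl mulVmx // scalemx1.
have eigA i : eigenvalue A (v i).
  rewrite /eigenvalue /eigenspace kermx_eq0 row_free_unit subE.
  rewrite !unitmx_mul !negb_and; apply/orP; left; apply/orP; right.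
  rewrite unitmxE det_diag unitfE (bigD1 i) //= !mxE subrr mul0r.
  by rewrite eqxx.
have rankA (s : seq 'I_n) (lam : C) : uniq s -> {in s, v =1 fun=> lam} ->
    (\rank (A - lam%:M)%R <= n - size s)%N.
  move=> s_uniq vs; rewrite subE.
  apply: leq_trans (mxrankM_maxl _ _) (leq_trans (mxrankM_maxr _ _) _).
  apply: leq_trans (rank_diag_mx _) _.
  rewrite -(card_uniqP s_uniq) -[X in (X - _)%N]card_ord -(cardC (mem s)) addKn.
  apply: subset_leq_card; apply/fintype.subsetP => i; rewrite !inE !mxE subr_eq0.
  by apply: contra => /vs; rewrite /v => ->.
have pairP (s : seq 'I_n) : uniq s -> (n - 1 <= size s)%N ->
    exists i j, [/\ i \in s, j \in s, i != j & v i = v j].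
  move=> s_uniq sn; apply: contrapT => no_pair; apply: Abad.
  exists (map v s); split; rewrite ?size_map //; last first.
    by apply/allP => _ /mapP[i _ ->].
  rewrite map_inj_in_uniq // => i j si sj vij; apply/eqP/negPn/negP => ij.
  by apply: no_pair; exists i, j.
have [|i [j [_ _ ij vij]]] := pairP (enum 'I_n) (enum_uniq _).
  by rewrite size_enum_ord leq_subr.
have [||k [l [si sj kl vkl]]] := pairP (rem i (enum 'I_n)).
- by rewrite rem_uniq // enum_uniq.
- by rewrite size_rem ?mem_enum // size_enum_ord subn1.
move: si sj; rewrite !mem_rem_uniq ?enum_uniq // !inE => /andP[ki _] /andP[li _].
have [vik|vik] := eqVneq (v i) (v k); [left|right]; split=> //.
  exists (complex.Re (v i)); rewrite -vR.
  apply: (rankA [:: i; k; l]).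
    by rewrite /= !inE !negb_or (eq_sym i k) (eq_sym i l) ki li kl.
  by move=> m; rewrite !inE => /or3P[] /eqP -> //; rewrite vik.
exists (complex.Re (v i)), (complex.Re (v k)); split; rewrite -?vR.
- by apply: contra_neq vik => vik; rewrite vR vik -vR.
- apply: (rankA [:: i; j]); first by rewrite /= inE ij.
  by move=> m; rewrite !inE => /orP[] /eqP ->.
- apply: (rankA [:: k; l]); first by rewrite /= inE kl.
  by move=> m; rewrite !inE => /orP[] /eqP ->.
Qed.

End LowRank.
Arguments triple {R} n.
Arguments two_pairs {R} n.

(** * Polynomial charts of the bad set *)

Section Charts.
Variable R : realType.
Local Notation C := R[i].

(** A weak form of having real dimension at most [m]. The charts share one parameter type and may
    also take values outside [Z]. *)
Definition covered n m (Z : set 'M[C]_n) :=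
  exists (K I : finType) (F : K -> (I -> R) -> 'M[C]_n),
    [/\ (#|I| <= m)%N, forall k, polymx (F k) & forall A, Z A -> exists k t, A = F k t].

(** The sum of [Z] and the real spans of [p] members of [L], repetitions allowed; the choice [jj]
    becomes part of the chart index. *)
Definition add_combs n p q (L : 'I_q -> 'M[C]_n) (Z : set 'M[C]_n) : set 'M[C]_n :=
  [set A | exists (jj : {ffun 'I_p -> 'I_q}) (c : 'I_p -> R),
    Z (A + \sum_a (c a)%:C *: L (jj a))].

Lemma covered_add_combs n m p q (L : 'I_q -> 'M[C]_n) (Z : set 'M[C]_n) :
  covered m Z -> covered (m + p) (add_combs p L Z).
Proof.
move=> [K [I [F [Im FP ZF]]]].
exists (K * {ffun 'I_p -> 'I_q})%type, (I + 'I_p)%type.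
exists (fun (k : K * {ffun 'I_p -> 'I_q}) t => F k.1 (t \o inl) +
  \sum_(a < p) (- (t (inr a))%:C) *: L (k.2 a)).
split=> [|k|A [jj [c]] /ZF[k [t AE]]].
- by rewrite card_sum card_ord leq_add2r.
- apply: polymxD (polymx_comp _ (FP _)) _.
  apply: polymx_sum => a; apply: polymxZ (polymx_cst _ _).
  exact: polyfunN (polyfun_var _).
- exists (k, jj), (fun x => match x with inl i => t i | inr a => c a end) => /=.
  rewrite -[F _ _]/(F k t) -AE -addrA -big_split big1 ?addr0 // => a _ /=.
  by rewrite scaleNr subrr.
Qed.

(** The map [h] locates the real parts (tag [false]) and the imaginary parts (tag [true]) of the
    entries among the parameters. *)
Definition param_mx (I : Type) m n (h : bool * ('I_m * 'I_n) -> I) (t : I -> R) :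
    'M[C]_(m, n) :=
  \matrix_(i, j) ((t (h (false, (i, j))))%:C + 'i * (t (h (true, (i, j))))%:C).

Lemma polymx_param_mx (I : Type) m n (h : bool * ('I_m * 'I_n) -> I) :
  polymx (@param_mx I m n h).
Proof.
move=> i j; apply: eq_polyfun (polyfunD (polyfun_var (h (false, (i, j))))
  (polyfunM (polyfun_cst 'i) (polyfun_var (h (true, (i, j)))))) => t.
by rewrite mxE.
Qed.

Definition param_herm (I : Type) n (h : 'I_n * 'I_n -> I) (t : I -> R) : 'M[C]_n :=
  herm_of (\matrix_(i, j) (t (h (i, j)))%:C).

Lemma polymx_param_herm (I : Type) n (h : 'I_n * 'I_n -> I) :
  polymx (@param_herm I n h).
Proof.
have tP : polymx (fun t : I -> R => \matrix_(i, j) (t (h (i, j)))%:C : 'M[C]_n).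
  by move=> i j; apply: eq_polyfun (polyfun_var (h (i, j))) => t; rewrite mxE.
have tTP : polymx (fun t : I -> R => (\matrix_(i, j) (t (h (i, j)))%:C : 'M[C]_n)^T).
  by move=> i j; apply: eq_polyfun (polyfun_var (h (j, i))) => t; rewrite !mxE.
apply: polymxD; apply: polymxZ (polyfun_cst _) _; apply: polymxD => //.
by move=> i j; apply: eq_polyfun (polyfunN (tTP i j)) => t; rewrite !mxE.
Qed.

Lemma polymx_frame (I : Type) a r (f : 'I_r -> 'I_(a + r)) g
    (Q : (I -> R) -> 'M[C]_(r, a)) :
  polymx Q -> polymx (fun t => frame f g (Q t)).
Proof.
by move=> QP; apply: polymxD (polymx_cst _ _) (polymxM QP (polymx_cst _ _)).
Qed.

Lemma polymx_sandwich (I : Type) m n (M : (I -> R) -> 'M[C]_(m, n)) P :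
  polymx M -> polymx P -> polymx (fun t => (M t)^t* *m P t *m M t).
Proof.
move=> MP PP; apply: (polymxM _ MP); apply: (polymxM _ PP).
exact: polymx_conj MP.
Qed.

Lemma polymx_scalar (I : Type) n (f : (I -> R) -> C) :
  polyfun f -> polymx (fun t => (f t)%:M : 'M[C]_n).
Proof.
move=> fP i j; apply: eq_polyfun (polyfunM fP (polyfun_cst (i == j)%:R)) => t.
by rewrite mxE mulr_natr.
Qed.

Lemma param_mxP (I : Type) m n (h : bool * ('I_m * 'I_n) -> I) (Q : 'M[C]_(m, n)) t :
  (forall b i j, t (h (b, (i, j))) =
    (if b then complex.Im (Q i j) else complex.Re (Q i j))) ->
  param_mx h t = Q.
Proof.
move=> tE; apply/matrixP => i j; rewrite mxE !tE.
by rewrite [RHS]complexE.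
Qed.

Lemma param_hermP (I : Type) n (h : 'I_n * 'I_n -> I) (P : 'M[C]_n) t :
  P^t* = P -> (forall i j, t (h (i, j)) = complex.Re (coord_of P i j)) ->
  param_herm h t = P.
Proof.
move=> PP tE; rewrite -[RHS]coord_ofK; congr herm_of.
apply/matrixP => i j; rewrite mxE tE -conjc_id //; exact: coord_of_real.
Qed.

(** Apply [herm_lowrank] with [a = 3] to [A - lam]: with [r = n - 3] this takes
    [1 + 6 * r + r ^ 2 = n ^ 2 - 8] parameters, within the bound shared with [two_pairs]. *)
Lemma covered_triple n : (3 <= n)%N -> covered (n ^ 2 - 6) (@triple R n).
Proof.
move=> /subnKC <-; set r := (n - 3)%N.
exists ({ffun 'I_r -> 'I_(3 + r)} * {ffun 'I_3 -> 'I_(3 + r)})%type.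
exists (unit + (bool * ('I_r * 'I_3)) + ('I_r * 'I_r))%type.
exists (fun (k : {ffun 'I_r -> 'I_(3 + r)} * {ffun 'I_3 -> 'I_(3 + r)}) t =>
  (t (inl (inl tt)))%:C%:M +
  let M := frame k.1 k.2 (param_mx (inl \o inr) t) in M^t* *m param_herm inr t *m M).
split=> [|k|A [AA [lam rA]]].
- by rewrite !card_sum !card_prod card_unit card_bool !card_ord; nia.
- apply: polymxD; first exact/polymx_scalar/polyfun_var.
  apply: polymx_sandwich; last exact: polymx_param_herm.
  by apply: polymx_frame; exact: polymx_param_mx.
- have [||f [g [Q [P [_ PP HE]]]]] := @herm_lowrank _ 3 r (A - lam%:C%:M).
  + by rewrite conj_mxB AA conj_scalar_mx.
  + by rewrite addKn in rA.
  exists (f, g), (fun x => match x with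
    | inl (inl _) => lam
    | inl (inr (b, (i, j))) => if b then complex.Im (Q i j) else complex.Re (Q i j)
    | inr (i, j) => complex.Re (coord_of P i j) end) => /=.
  rewrite (@param_mxP _ _ _ _ Q) // (@param_hermP _ _ _ P) // -HE addrC subrK //.
Qed.

(* For a left eigenvector [u] of [A] with eigenvalue [lam + nu], the matrices [P]
   and [nu *: invmx (M *m M ^t* )] agree on the vector [u *m M ^t* ]. *)
Lemma deflate k (lam nu : R) (A : 'M[C]_(2 + (2 + k)))
    (M : 'M[C]_(2 + k, 2 + (2 + k))) P :
  row_free M -> A = lam%:C%:M + M^t* *m P *m M -> nu != 0 ->
  (\rank (A - (lam + nu)%:C%:M)%R <= 2 + k)%N ->
  (\rank (P - nu%:C *: invmx (M *m M^t*))%R <= k)%N.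
Proof.
move=> Mfree AE nu0 rA.
set T := M *m M^t*; have Tu : T \in unitmx by exact: gram_unit.
set U := kermx (A - (lam + nu)%:C%:M).
have rU : (2 <= \rank U)%N by rewrite mxrank_ker; lia.
have UE : U *m (M^t* *m P *m M) = nu%:C *: U.
  have := mulmx_ker (A - (lam + nu)%:C%:M); rewrite -/U AE.
  rewrite [X in U *m X](_ : _ = M^t* *m P *m M - nu%:C%:M); last first.
    by rewrite rmorphD raddfD opprD addrACA subrr add0r.
  by rewrite mulmxBr mul_mx_scalar => /subr0_eq.
set S := P - _.
have US : U *m M^t* *m S = 0.
  rewrite mulmxBr -scalemxAr; apply/eqP; rewrite subr_eq0; apply/eqP.
  have -> : U *m M^t* *m P = U *m (M^t* *m P *m M) *m M^t* *m invmx T.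
    by rewrite !mulmxA -(mulmxA _ M) mulmxK.
  by rewrite UE -!scalemxAl.
have : (\rank (U *m M^t*) <= \rank (kermx S))%N by apply: mxrankS; apply/sub_kermxP.
rewrite mxrank_ker.
(* Since [nu] is nonzero, [U] can be recovered from [U *m M^t*], so no rank is lost. *)
have : (\rank U <= \rank (U *m M^t*))%N.
  have {1}-> : U = nu%:C^-1 *: (U *m M^t* *m (P *m M)).
    by rewrite -mulmxA (mulmxA _ P) UE scalerA mulVf ?scale1r // fmorph_eq0.
  by apply: leq_trans (mxrank_scale _ _) (mxrankM_maxl _ _).
by have := rank_leq_row S; lia.
Qed.

(** Two deflations: [A - lam = M^t* *m P *m M], and then [P - nu *: invmx T] has rank at most [k] by
    [deflate], where [T = M *m M^t*]. To stay polynomial, [invmx T] is replaced by [\adj T] and its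
    scalar by [nu / \det T]. For [n = 4 + k] this gives [2 + 4 * (2 + k) + 4 * k + k ^ 2 = n ^ 2 -
    6] parameters. *)
Lemma covered_two_pairs n : (3 <= n)%N -> covered (n ^ 2 - 6) (@two_pairs R n).
Proof.
move=> n3; have [n4|] := leqP 4 n; last first.
  (* For [n = 3] the set is empty, and so is the family of charts: the nonzero scalar matrix
     [mu - lam] would have rank at most 2. *)
  move=> n_lt; have {n_lt} n_eq : n = 3%N by lia.
  exists void, void, (of_void _); split=> [|[]|A].
    by rewrite card_void.
  move=> [_ [lam [mu [lam_mu rl rm]]]]; exfalso.
  have : (\rank ((mu - lam)%:C%:M : 'M[C]_n) <= (n - 2) + (n - 2))%N.
    have -> : (mu - lam)%:C%:M = (A - lam%:C%:M) - (A - mu%:C%:M).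
      by rewrite opprB [RHS]addrC addrA subrK rmorphB raddfB.
    apply: leq_trans (mxrank_add _ _) _; apply: leq_add => //.
    by rewrite mxrank_opp.
  rewrite -scalemx1 mxrank_scale_nz ?mxrank1 ?fmorph_eq0; first lia.
  by rewrite subr_eq0 eq_sym.
have [k nE] : exists k, n = (2 + (2 + k))%N by exists (n - 4)%N; lia.
subst n => {n3 n4}.
pose frames a r := ({ffun 'I_r -> 'I_(a + r)} * {ffun 'I_a -> 'I_(a + r)})%type.
pose I := (bool + (bool * ('I_(2 + k) * 'I_2)) + (bool * ('I_k * 'I_2)) +
  ('I_k * 'I_k))%type.
exists (frames 2%N (2 + k)%N * frames 2%N k)%type, I.
exists (fun (x : (frames 2%N (2 + k)%N * frames 2%N k)%type) t =>
  let M := frame x.1.1 x.1.2 (param_mx (inl \o inl \o inr) t) in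
  let N := frame x.2.1 x.2.2 (param_mx (inl \o inr) t) in
  (t (inl (inl (inl true))))%:C%:M +
  M^t* *m ((t (inl (inl (inl false))))%:C *: \adj (M *m M^t*) +
           N^t* *m param_herm inr t *m N) *m M).
split=> [|x|A [AA [lam [mu [lam_mu rl rm]]]]].
- by rewrite !card_sum !card_prod !card_bool !card_ord; nia.
- pose M (t : I -> R) := frame x.1.1 x.1.2 (param_mx (inl \o inl \o inr) t).
  have MP : polymx M by apply: polymx_frame; exact: polymx_param_mx.
  apply: polymxD; first exact/polymx_scalar/polyfun_var.
  apply: (polymx_sandwich MP); apply: polymxD.
    apply: polymxZ (polyfun_var _) _; apply: polymx_adj.
    exact: polymxM MP (polymx_conj MP).
  apply: polymx_sandwich; last exact: polymx_param_herm.
  by apply: polymx_frame; exact: polymx_param_mx.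
- have [||f [g [Q [P [Mfree PP HE]]]]] := @herm_lowrank _ 2 (2 + k) (A - lam%:C%:M).
  + by rewrite conj_mxB AA conj_scalar_mx.
  + by rewrite addKn in rl.
  set M := frame f g Q in Mfree HE.
  set nu := mu - lam; have nu0 : nu != 0 by rewrite subr_eq0 eq_sym.
  set T := M *m M^t*; have Tu : T \in unitmx by exact: gram_unit.
  (* As [T] is hermitian, its determinant is real and [nu / d] is admissible as a real parameter. *)
  have TT : T^t* = T by rewrite conj_mxM conj_mxK.
  have detT : \det T = (complex.Re (\det T))%:C.
    by apply: conjc_id; exact: herm_det.
  set d := complex.Re _ in detT.
  have d0 : d != 0.
    by apply: contraTneq Tu => d0; rewrite unitmxE detT d0 unitr0.
  have TV : nu%:C *: invmx T = (nu / d)%:C *: \adj T.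
    by rewrite /invmx Tu detT scalerA rmorphM /= fmorphV.
  set S := P - nu%:C *: invmx T.
  have SS : S^t* = S.
    rewrite /S TV conj_mxB PP conj_mxZ; congr (_ - _ *: _).
    by rewrite trmx_adj map_mx_adj TT.
  have rS : (\rank S <= k)%N.
    apply: (deflate (lam := lam) (A := A) Mfree _ nu0); last first.
      by rewrite [lam + _]addrC subrK addKn in rm *.
    by rewrite -HE addrC subrK.
  have [f' [g' [Q' [P' [_ PP' SE]]]]] := @herm_lowrank _ 2 k S SS rS.
  exists ((f, g), (f', g')), (fun x => match x with
    | inl (inl (inl b)) => if b then lam else nu / d
    | inl (inl (inr (b, (i, j)))) => if b then complex.Im (Q i j) else complex.Re (Q i j)
    | inl (inr (b, (i, j))) => if b then complex.Im (Q' i j) else complex.Re (Q' i j)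
    | inr (i, j) => complex.Re (coord_of P' i j) end) => /=.
  rewrite (@param_mxP _ _ _ _ Q) // (@param_mxP _ _ _ _ Q') // (@param_hermP _ _ _ P') //.
  have PE : nu%:C *: invmx T + S = P by rewrite /S addrC subrK.
  by rewrite -/M -/T -TV -SE PE -HE addrC subrK.
Qed.

End Charts.

(** * Thin sets and how to avoid them *)

Section Thin.
Variable R : realType.
Local Notation C := R[i].

(** In the coordinates of [coord_of] this is the monomial curve of [polyfun_image_thin]. It is
    hermitian for real [s]; complex [s] is allowed so that parameters can be compared with roots of
    a complex polynomial. *)
Definition curve n M (s : C) : 'M[C]_n :=
  herm_of (\matrix_(i, j) s ^+ (M ^ enum_rank (i, j))).

(** Stands in for being negligible. One threshold [M0] serves all base points and all larger [M], so
    that two thin sets can be tested on the same curve. *)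
Definition thin n (Z : set 'M[C]_n) :=
  exists M0, forall M, (M0 <= M)%N -> forall A0, exists2 q : {poly C}, q != 0 &
    forall s, Z (A0 + curve n M s) -> root q s.

Lemma thinU n (Z Z' : set 'M[C]_n) : thin Z -> thin Z' -> thin (Z `|` Z').
Proof.
move=> [M1 Z1] [M2 Z2]; exists (maxn M1 M2) => M; rewrite geq_max => /andP[M1M M2M] A0.
have [q q0 Zq] := Z1 M M1M A0; have [q' q'0 Zq'] := Z2 M M2M A0.
exists (q * q'); first by rewrite mulf_neq0.
by move=> s [/Zq|/Zq']; rewrite rootM => ->; rewrite ?orbT.
Qed.

(** In the coordinates of [coord_of] a chart maps at most [m] parameters to [n ^ 2 > m] coordinates,
    so [polyfun_image_thin] applies; the polynomials of the finitely many charts are multiplied. *)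
Lemma covered_thin n m (Z : set 'M[C]_n) : (m < n ^ 2)%N -> covered m Z -> thin Z.
Proof.
move=> mn [K [I [F [Im FP ZF]]]].
have Icard : (#|I| < #|{: 'I_n * 'I_n}|)%N.
  by rewrite card_prod !card_ord; apply: leq_ltn_trans Im _.
pose P k (t : I -> R) (x : 'I_n * 'I_n) := coord_of (F k t) x.1 x.2.
have PP k x : polyfun (P k ^~ x).
  apply: eq_polyfun (polyfunD
    (polyfunM (polyfun_cst 2^-1) (polyfunD (FP k x.1 x.2) (FP k x.2 x.1)))
    (polyfunM (polyfun_cst (- ('i / 2)))
      (polyfunD (FP k x.1 x.2) (polyfunN (FP k x.2 x.1))))) => t.
  by rewrite /P /coord_of !mxE mulNr.
have /choice[M0 thinF] := fun k => polyfun_image_thin Icard (PP k).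
exists (\max_k M0 k) => M MM0 A0.
have /choice[q qP] : forall k, exists q : {poly C}, q != 0 /\ forall s t,
    (F k t = A0 + curve n M s) -> root q s.
  move=> k; have [|q q0 qroot] := thinF k M _ (fun x => coord_of A0 x.1 x.2).
    by apply: leq_trans MM0; exact: leq_bigmax.
  exists q; split=> // s t FE; apply: (qroot s t) => -[i j]; rewrite /P FE.
  suff -> : s ^+ (M ^ enum_rank (i, j)) = coord_of (curve n M s) i j.
    by rewrite /coord_of !mxE; ring.
  by rewrite herm_ofK mxE.
exists (\prod_k q k).
  by rewrite prodf_seq_neq0; apply/allP => k _; case: (qP k) => ->.
move=> s /ZF[k [t]] /esym/(proj2 (qP k)) qs.
by rewrite (bigD1 k) //= rootM qs.
Qed.

(** Dominates [op_norm] (see [op_norm_le]) and is easier to estimate; all approximations are made in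
    this norm. *)
Definition sum_norm n (A : 'M[C]_n) : R := \sum_i \sum_j Normc.normc (A i j).

Lemma normc_norm (z : C) : (Normc.normc z)%:C = `|z|.
Proof. by []. Qed.

(** Each of the two summands of [herm_of] contributes at most [s] to an entry, hence the factor
    2. *)
Lemma sum_norm_herm_of n (Y : 'M[C]_n) (s : R) :
  (forall i j, `|Y i j| <= s%:C) -> sum_norm (herm_of Y) <= (n * n)%:R * (2 * s).
Proof.
move=> Ys; apply: (@le_trans _ _ (\sum_(i < n) \sum_(j < n) 2 * s)); last first.
  by rewrite !sumr_const !card_ord -mulrnA -[leLHS]mulr_natl.
apply: ler_sum => i _; apply: ler_sum => j _.
rewrite -lecR normc_norm /herm_of !mxE.
move: (Ys i j) (Ys j i) => an bn; set a := Y i j in an *; set b := Y j i in bn *.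
apply: le_trans (ler_normD _ _) _; rewrite !normrM normfV normr_nat normCi mul1r.
rewrite -mulrDr ler_pdivrMl ?ltr0n // rmorphM rmorph_nat.
have := lerD (lerD an bn) (lerD an bn).
have := lerD (ler_normD a b) (ler_normB a b) => abn /(le_trans abn) /le_trans; apply.
by rewrite le_eqVlt; apply/orP; left; apply/eqP; ring.
Qed.

(** As [M > 0], each exponent is positive, so every coordinate of the curve is at most [s]. *)
Lemma sum_norm_curve n M (s : R) : (0 < M)%N -> 0 < s <= 1 ->
  sum_norm (curve n M s%:C) <= (n * n)%:R * (2 * s).
Proof.
move=> M0 /andP[s0 s1]; apply: sum_norm_herm_of => i j; rewrite mxE.
set k := enum_rank _.
rewrite normrX ger0_norm ?ler0c ?(ltW s0) // -rmorphXn lecR.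
rewrite -(prednK (_ : 0 < M ^ k)%N) ?expn_gt0 ?M0 // exprS.
by rewrite ler_piMr ?exprn_ile1 // ltW.
Qed.

(** The curve through [A0] stays hermitian and close to [A0] for small real [s], and only the
    finitely many roots of [q] are excluded. *)
Lemma thin_avoid n (Z : set 'M[C]_n) (A0 : 'M[C]_n) (delta : R) :
  thin Z -> A0^t* = A0 -> 0 < delta ->
  exists A : 'M[C]_n, [/\ A^t* = A, sum_norm (A - A0) < delta & ~ Z A].
Proof.
move=> [M0 Zthin] AA0 delta0.
have [q q0 Zq] := Zthin (maxn M0 1) (leq_maxl _ _) A0.
set M := maxn M0 1 in Zq; have M_gt0 : (0 < M)%N by rewrite leq_max orbT.
(* Makes [(n * n) * (2 * e)] smaller than [delta]; the 1 in the denominator gives strictness and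
   covers [n = 0]. *)
pose e := Num.min 1 (delta / ((n * n)%:R * 2 + 1)).
have d_gt0 : 0 < (n * n)%:R * 2 + 1 :> R by rewrite ltr_wpDl ?mulr_ge0 ?ler0n.
have e0 : 0 < e by rewrite lt_min ltr01 divr_gt0.
pose s k : R := e / k.+1%:R.
have [k qk] : exists k, ~~ root q (s k)%:C.
  apply: contrapT => noroot.
  have : (size [seq (s k)%:C | k <- iota 0 (size q)] < size q)%N.
    apply: max_poly_roots => //.
      apply/allP => _ /mapP[k _ ->]; apply/negPn/negP => qk.
      by apply: noroot; exists k.
    rewrite map_inj_uniq ?iota_uniq // => k l /complexI /(mulfI (lt0r_neq0 e0)).
    by move=> /invr_inj /eqP; rewrite eqr_nat eqSS => /eqP.
  by rewrite size_map size_iota ltnn.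
have sk0 : 0 < s k by rewrite divr_gt0.
have ske : s k <= e.
  by rewrite ler_pdivrMr ?ltr0n //; apply: ler_peMr; rewrite ?ler1n // ltW.
exists (A0 + curve n M (s k)%:C); split.
- rewrite conj_mxD AA0 herm_of_herm // => i j.
  by rewrite mxE -rmorphXn conjc_real.
- rewrite addrC addKr; apply: le_lt_trans (sum_norm_curve _ _ _) _ => //.
    by rewrite sk0 (le_trans ske) // ge_min lexx.
  have : e <= delta / ((n * n)%:R * 2 + 1) by rewrite ge_min lexx orbT.
  rewrite ler_pdivlMr // => eD.
  have : s k * ((n * n)%:R * 2 + 1) <= delta.
    by apply: le_trans eD; rewrite ler_pM2r.
  lra.
- by move=> /Zq; apply/negP.
Qed.

Lemma almost_simple_small n (A : 'M[C]_n) : (n <= 2)%N -> almost_simple A.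
Proof.
case: n A => [|[|[|//]]] A _; [by exists [::]..|].
have [//|a Aa] := eigenvalue_closed A.
by exists [:: a]; rewrite /= Aa.
Qed.

Lemma generic_perturbation n q (L : 'I_q -> 'M[C]_n) (A0 : 'M[C]_n) (delta : R) :
  (forall k, (L k)^t* = L k) -> A0^t* = A0 -> 0 < delta ->
  exists A : 'M[C]_n, [/\ A^t* = A, sum_norm (A - A0) < delta &
    forall (jj : {ffun 'I_4 -> 'I_q}) (c : 'I_4 -> R),
      almost_simple (A + \sum_a (c a)%:C *: L (jj a))].
Proof.
move=> LL AA0 delta0.
have [n2|n3] := leqP n 2.
  exists A0; split=> // [|jj c]; last exact: almost_simple_small.
  rewrite subrr /sum_norm big1 // => i _; rewrite big1 // => j _.
  by rewrite mxE Normc.normc0.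
(* Codimension 6 minus the 4 parameters of a combination leaves 2; [n >= 3] makes the truncated
   subtraction exact. *)
have n_lt : (n ^ 2 - 6 + 4 < n ^ 2)%N by nia.
have Zthin := thinU
  (covered_thin n_lt (covered_add_combs 4 L (covered_triple R n3)))
  (covered_thin n_lt (covered_add_combs 4 L (covered_two_pairs R n3))).
have [A [AA AA0d AZ]] := thin_avoid Zthin AA0 delta0.
exists A; split=> // jj c; apply: contrapT => /not_almost_simple.
case=> [|T|D].
- rewrite conj_mxD AA; congr (_ + _).
  rewrite linear_sum map_mx_sum; apply: eq_bigr => a _.
  by rewrite conj_mxZ LL.
- by apply: AZ; left; exists jj, c.
- by apply: AZ; right; exists jj, c.
Qed.
End Thin.

(** * Partitions of unity *)

Section Covers.
Variables (R : realType) (X : topologicalType).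

(** Local finiteness of a sequence: a single bound [K] on the indices is valid in a
    neighbourhood. *)
Definition eventually_off (W : nat -> set X) :=
  forall x : X, exists K, \forall y \near x, forall i, (K <= i)%N -> ~ W i y.

Lemma continuous_finite_sum (k : numFieldType) (V : normedModType k)
    (F : nat -> X -> V) K :
  (forall i, continuous (F i)) -> continuous (fun x => \sum_(i < K) F i x).
Proof.
move=> Fc; elim: K => [|K IHK].
  rewrite (_ : (fun _ => _) = cst 0); first by move=> x; exact: cvg_cst.
  by apply/funext => x; rewrite big_ord0.
rewrite (_ : (fun _ => _) = (fun x => \sum_(i < K) F i x) \+ F K).
  by move=> x; exact: cvgD (IHK x) (Fc K x).
by apply/funext => x; rewrite big_ord_recr.
Qed.

Lemma near_continuous (T : topologicalType) (g : X -> T) :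
  (forall x, exists2 h : X -> T, {for x, continuous h} & \forall y \near x, g y = h y) ->
  continuous g.
Proof.
move=> gP x; have [h hx gh] := gP x; rewrite /continuous_at (nbhs_singleton gh).
apply: cvg_trans hx; apply: near_eq_cvg.
by near=> y; apply/esym; near: y.
Unshelve. all: by end_near. Qed.

Lemma open_lt_fun (h h' : X -> R) : continuous h -> continuous h' ->
  open [set x | h x < h' x].
Proof.
move=> hc hc'.
have -> : [set x | h x < h' x] = (fun x => h' x - h x) @^-1` [set r | 0 < r].
  by apply/seteqP; split=> x /=; rewrite subr_gt0.
apply: open_comp; last exact: open_gt.
by move=> x _; exact: cvgB (hc' x) (hc x).
Qed.

(** Take [U i] where [h i > 0] and [h j < 1 / (i + 1)] for all [j < i]. The least [i] with
    [h i x > 0] covers [x]. If [h j x > 1 / (k + 1)], this persists near [x] and excludes every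
    [U i] with [i > j] and [i >= k]. *)
Lemma locally_finite_refinement (h : nat -> X -> R) :
  (forall i, continuous (h i)) -> (forall x, exists i, 0 < h i x) ->
  exists U : nat -> set X, [/\ open_covering U, eventually_off U &
    forall i x, U i x -> 0 < h i x].
Proof.
move=> hc hpos.
have below_open m e : open [set x | forall j, (j < m)%N -> h j x < e].
  elim: m => [|m IHm].
    by rewrite (_ : [set x | _] = setT); [exact: openT|apply/seteqP; split].
  rewrite (_ : [set x | _] =
      [set x | forall j, (j < m)%N -> h j x < e] `&` [set x | h m x < e]).
    by apply: openI => //; apply: open_lt_fun => // x; exact: cvg_cst.
  apply/seteqP; split=> x /=; last first.
    by move=> [hx hmx] j; rewrite ltnS leq_eqVlt => /orP[/eqP ->|/hx].
  by move=> hx; split=> [j jm|]; apply: hx => //; exact: ltnW.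
exists (fun i => [set x | 0 < h i x] `&`
  [set x | forall j, (j < i)%N -> h j x < i.+1%:R^-1]).
split; last by move=> i x [].
- split=> [i|].
    apply: openI; last exact: below_open.
    by apply: open_lt_fun => // x; exact: cvg_cst.
  apply/seteqP; split=> // x _.
  have := hpos x => /(@ex_minnP (fun i => 0 < h i x)) [i hi imin].
  exists i => //; split=> // j ji /=.
  apply: (@le_lt_trans _ _ 0); last by rewrite invr_gt0.
  by rewrite leNgt; apply/negP => /imin; rewrite leqNgt ji.
- move=> x; have [j /ltr_add_invr[k]] := hpos x; rewrite add0r => hjk.
  exists (k + j).+1.
  have near_hj : \forall y \near x, k.+1%:R^-1 < h j y.
    apply: open_nbhs_nbhs; split=> //.
    by apply: open_lt_fun => // y; exact: cvg_cst.
  near=> y => i Ki [_ /(_ j)] /=.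
  have ji : (j < i)%N by rewrite (leq_trans _ Ki) // ltnS leq_addl.
  move=> /(_ ji); apply/negP; rewrite -leNgt.
  apply: le_trans (ltW (near near_hj y _)) => //.
  by rewrite lef_pV2 ?posrE ?ltr0n // ler_nat ltnS (leq_trans _ (ltnW Ki)) // leq_addr.
Unshelve. all: by end_near. Qed.

(** Choose for each member of a refinement one [U i] containing it, and unite the members with the
    same [i]. Multiplicity cannot grow, and the indices stay in [nat], so local finiteness of [U]
    carries over to [W]. *)
Lemma covering_dim_shrink d (U : nat -> set X) : covering_dim_le X d ->
  open_covering U -> exists W : nat -> set X,
    [/\ open_covering W, forall i, W i `<=` U i &
        forall x, ([set i | W i x] #<= `I_d.+1)%card].
Proof.
move=> dimX /dimX[J [V [[Vo Vcov] /choice[r rP] Vd]]].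
exists (fun i => \bigcup_(j in [set j | r j = i]) V j); split.
- split=> [i|]; first by apply: bigcup_open => j _; exact: Vo.
  apply/seteqP; split=> // x _; have : (\bigcup_j V j) x by rewrite Vcov.
  by move=> [j _ Vjx]; exists (r j) => //; exists j.
- by move=> i x [j <- Vjx]; exact: rP Vjx.
- move=> x; apply: card_le_trans (Vd x).
  apply: card_le_trans (subset_card_le _) (card_image_le r _).
  by move=> i [j ji Vjx]; exists j.
Qed.

Lemma normal_bump (F W : set X) : normal_space X -> closed F -> open W -> F `<=` W ->
  exists phi : X -> R, [/\ continuous phi, forall x, 0 <= phi x,
    forall x, F x -> 0 < phi x & forall x, phi x != 0 -> W x].
Proof.
move=> normalX Fc Wo FW.
have sep : uniform_separator (~` W) F.
  have [sepP _] := @normal_separatorP R X; apply: sepP => //; first exact: open_closedC.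
  by rewrite setIC; apply/disjoints_subset; rewrite setCK.
exists (Urysohn (~` W) F); split.
- exact: Urysohn_continuous.
- move=> x; have /(_ (Urysohn (~` W) F x)) := @Urysohn_range _ R (~` W) F.
  by rewrite /= in_itv /= => /(_ (ex_intro2 _ _ x I erefl)) /andP[].
- move=> x Fx; suff -> : Urysohn (~` W) F x = 1 :> R by exact: ltr01.
  by apply: Urysohn_sub1 sep _ _; exists x.
- move=> x; apply: contra_neqP => Wx.
  by apply: Urysohn_sub0 sep _ _; exists x.
Qed.

(** The cover is shrunk one member at a time. By [eventually_off] each point lies outside some
    [tail K], so one of the first [K] bumps is positive there. *)
Lemma subordinate_bumps (W : nat -> set X) : normal_space X ->
  open_covering W -> eventually_off W ->
  exists phi : nat -> X -> R, [/\ forall i, continuous (phi i),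
    forall i x, 0 <= phi i x, forall i x, phi i x != 0 -> W i x &
    forall x, exists i, 0 < phi i x].
Proof.
move=> normalX [Wo Wcov] Woff.
pose tail i := \bigcup_(j in [set j | (i <= j)%N]) W j.
have tail_open i : open (tail i) by apply: bigcup_open => j _; exact: Wo.
have tailS i : tail i = W i `|` tail i.+1.
  apply/seteqP; split=> x.
    move=> [j /=]; rewrite leq_eqVlt => /orP[/eqP <-|ij] Wjx; first by left.
    by right; exists j.
  by move=> [Wix|[j /= ij Wjx]]; [exists i => /=|exists j => //=; exact: ltnW].
(* The sets [G] below are the union of the supports chosen so far; each new
   bump is positive on the closed part of [W i] that nothing else covers. *)
have /choice[pick pickP] : forall Gi : set X * nat, exists phi : X -> R,
    open Gi.1 -> Gi.1 `|` tail Gi.2 = setT -> [/\ continuous phi, forall x, 0 <= phi x,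
      forall x, phi x != 0 -> W Gi.2 x &
      (Gi.1 `|` [set x | 0 < phi x]) `|` tail Gi.2.+1 = setT].
  move=> [G i] /=.
  have [[Go Gcov]|] := pselect (open G /\ G `|` tail i = setT); last first.
    by move=> Gbad; exists (fun=> 0); move=> Go Gcov; case: Gbad.
  have [||phi [phi_c phi0 phi_pos phiW]] :=
      @normal_bump (~` (G `|` tail i.+1)) (W i) normalX _ (Wo i).
  - by apply: open_closedC; exact: openU.
  - move=> x; have : (G `|` tail i) x by rewrite Gcov.
    by rewrite tailS => -[Ox|[//|tx]] nx; exfalso; apply: nx; [left|right].
  exists phi => _ _; split=> //; apply/seteqP; split=> // x _.
  have [|nx] := pselect ((G `|` tail i.+1) x); first by case; [left; left|right].
  by left; right; exact: phi_pos.
(* The specification of [pick] is conditional, so [G] can be defined by recursion first and its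
   invariant [GP] proved afterwards. *)
pose G := fix G i := if i is j.+1 then G j `|` [set x | 0 < pick (G j, j) x] else set0.
have GP i : open (G i) /\ G i `|` tail i = setT.
  elim: i => [|i [Go Gcov]] /=.
    split; first exact: open0.
    rewrite set0U; apply/seteqP; split=> // x _.
    by have : (\bigcup_i W i) x by [rewrite Wcov]; move=> [i _ Wix]; exists i.
  have [phi_c _ _ cov] := pickP (G i, i) Go Gcov; split=> //.
  by apply: openU => //; apply: open_lt_fun => // x; exact: cvg_cst.
pose phi i := pick (G i, i).
have phiP i := pickP (G i, i) (GP i).1 (GP i).2.
exists phi; split=> [i|i|i|x]; try by case: (phiP i).
have [K /nbhs_singleton offx] := Woff x.
have : (G K `|` tail K) x by rewrite (GP K).2.
case=> [|[j /= Kj Wjx]]; last by case: (offx j Kj).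
elim: K {offx} => [//|K IHK] /= [/IHK//|phix]; by exists K.
Qed.

(** Allows the cutoff [K y] of a locally finite sum to be exchanged for a cutoff [K x] that is fixed
    near [x]. *)
Lemma sum_off (V : zmodType) (F : nat -> V) K K' :
  (forall i, (K <= i)%N -> F i = 0) -> (forall i, (K' <= i)%N -> F i = 0) ->
  \sum_(i < K) F i = \sum_(i < K') F i.
Proof.
wlog KK' : K K' / (K <= K')%N.
  by move=> H; case: (leqP K K') => [/H|/ltnW/H] {}H ? ?; [|apply/esym]; apply: H.
move=> FK _; rewrite -!(big_mkord xpredT F) [RHS](big_cat_nat (leq0n K) KK') //=.
rewrite [X in _ = _ + X]big_nat [X in _ = _ + X]big1 ?addr0 //.
by move=> i /andP[Ki _]; exact: FK.
Qed.

(** The sum over all [i] is encoded by the cutoff [K x], beyond which everything vanishes near [x];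
    the bumps are divided by this sum. *)
Lemma partition_of_unity (W : nat -> set X) : normal_space X ->
  open_covering W -> eventually_off W ->
  exists (p : nat -> X -> R) (K : X -> nat), [/\ forall i, continuous (p i),
    forall i x, 0 <= p i x, forall i x, p i x != 0 -> W i x,
    forall x, \forall y \near x, forall i, (K x <= i)%N -> p i y = 0 &
    forall x, \sum_(i < K x) p i x = 1].
Proof.
move=> normalX Wcov Woff.
have [phi [phi_c phi0 phiW phi_pos]] := subordinate_bumps normalX Wcov Woff.
have /choice[K phiK] : forall x : X, exists K,
    \forall y \near x, forall i, (K <= i)%N -> phi i y = 0.
  move=> x; have [K offK] := Woff x; exists K; near=> y => i Ki.
  apply: contra_notP (near offK y _ i Ki) => // /eqP; exact: phiW.
pose S x := \sum_(i < K x) phi i x.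
have Sc : continuous S.
  apply: near_continuous => x; exists (fun y => \sum_(i < K x) phi i y).
    by apply: continuous_finite_sum.
  near=> y; rewrite /S; apply: (@sum_off _ (phi ^~ y) (K y) (K x)).
    exact: nbhs_singleton (phiK y).
  by near: y; exact: phiK.
have S_gt0 x : 0 < S x.
  have [i phix] := phi_pos x.
  have iK : (i < K x)%N.
    rewrite ltnNge; apply/negP => /(nbhs_singleton (phiK x)) phi_eq0.
    by rewrite phi_eq0 ltxx in phix.
  rewrite /S (bigD1 (Ordinal iK)) //=; apply: ltr_wpDr => //.
  exact: sumr_ge0.
exists (fun i x => phi i x / S x), K; split.
- move=> i x; apply: cvgM; first exact: phi_c.
  by apply: cvgV; [rewrite gt_eqF|exact: Sc].
- by move=> i x; rewrite divr_ge0 // ltW.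
- by move=> i x; rewrite mulf_eq0 negb_or => /andP[/phiW].
- move=> x; apply: filterS (phiK x) => y phi_eq0 i /phi_eq0 ->.
  by rewrite mul0r.
- by move=> x; rewrite -big_distrl /= -/(S x) divff // gt_eqF.
Unshelve. all: by end_near. Qed.
End Covers.

(** * Norms and continuity *)

Section MatrixNorm.
Variable R : realType.
Local Notation C := R[i].

Lemma normcD (z w : C) : Normc.normc (z + w) <= Normc.normc z + Normc.normc w.
Proof. by rewrite -lecR rmorphD /= !normc_norm ler_normD. Qed.

Lemma normc_ge0 (z : C) : 0 <= Normc.normc z.
Proof. by rewrite -ler0c normc_norm normr_ge0. Qed.

Lemma sum_normD n (A B : 'M[C]_n) : sum_norm (A + B) <= sum_norm A + sum_norm B.
Proof.
rewrite -big_split; apply: ler_sum => i _; rewrite -big_split; apply: ler_sum => j _.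
by rewrite mxE normcD.
Qed.

Lemma sum_normZ n (a : R) (A : 'M[C]_n) : 0 <= a ->
  sum_norm (a%:C *: A) = a * sum_norm A.
Proof.
move=> a0; rewrite /sum_norm big_distrr; apply: eq_bigr => i _ /=.
rewrite big_distrr; apply: eq_bigr => j _ /=.
rewrite mxE; apply: (@complexI R); rewrite rmorphM /= !normc_norm normrM.
by rewrite ger0_norm ?ler0c.
Qed.

Lemma sum_normN n (A : 'M[C]_n) : sum_norm (- A) = sum_norm A.
Proof.
apply: eq_bigr => i _; apply: eq_bigr => j _; rewrite mxE.
by apply: (@complexI R); rewrite !normc_norm normrN.
Qed.

Lemma sum_norm_sum n (I : Type) (s : seq I) (F : I -> 'M[C]_n) :
  sum_norm (\sum_(i <- s) F i) <= \sum_(i <- s) sum_norm (F i).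
Proof.
elim/big_rec2: _ => [|i a B _ IH]; last first.
  by apply: le_trans (sum_normD _ _) _; rewrite lerD2l.
by rewrite /sum_norm big1 // => i _; rewrite big1 // => j _; rewrite mxE Normc.normc0.
Qed.

Lemma vec_norm_le n (v : 'cV[C]_n) : vec_norm v <= \sum_i Normc.normc (v i ord0).
Proof.
have v0 : 0 <= \sum_i Normc.normc (v i ord0).
  by apply: sumr_ge0 => i _; exact: normc_ge0.
rewrite -[leRHS](ger0_norm v0) -sqrtr_sqr ler_wsqrtr //.
rewrite expr2 big_distrl; apply: ler_sum => i _ /=.
rewrite expr2 ler_wpM2l ?normc_ge0 // (bigD1 i) //= lerDl.
by apply: sumr_ge0 => j _; exact: normc_ge0.
Qed.

Lemma normc_le_vec_norm n (v : 'cV[C]_n) i : Normc.normc (v i ord0) <= vec_norm v.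
Proof.
rewrite -[leLHS](ger0_norm (normc_ge0 _)) -sqrtr_sqr ler_wsqrtr //.
by rewrite (bigD1 i) //= lerDl; apply: sumr_ge0 => j _; exact: sqr_ge0.
Qed.

Lemma op_norm_le n (A : 'M[C]_n) : op_norm A <= sum_norm A.
Proof.
apply: ge_sup.
  (* The zero vector shows that the supremum is over a nonempty set. *)
  exists (vec_norm (A *m 0)), 0 => //=.
  by rewrite /vec_norm big1 ?sqrtr0 ?ler01 // => i _; rewrite mxE Normc.normc0 expr0n.
move=> _ [v /= v1 <-]; apply: le_trans (vec_norm_le _) _.
apply: ler_sum => i _; rewrite mxE.
have normc_sum (s : seq 'I_n) (F : 'I_n -> C) :
    Normc.normc (\sum_(j <- s) F j) <= \sum_(j <- s) Normc.normc (F j).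
  elim/big_rec2: _ => [|j a z _ IH]; first by rewrite Normc.normc0.
  by apply: le_trans (normcD _ _) _; rewrite lerD2l.
apply: le_trans (normc_sum _ _) _; apply: ler_sum => j _.
rewrite Normc.normcM ler_piMr ?normc_ge0 //.
exact: le_trans (normc_le_vec_norm _ _) v1.
Qed.

Lemma normc_continuous : continuous (@Normc.normc R : C -> R).
Proof.
move=> z; apply/(@cvgrPdist_lt _ _ _ (nbhs z) (nbhs_filter z)) => e e0; near=> w.
rewrite -ltcR; apply: (@le_lt_trans _ _ `|z - w|); last first.
  by near: w; exists e%:C => //=; rewrite ltcR.
have dist (x y : C) : Normc.normc x - Normc.normc y <= Normc.normc (x - y).
  by rewrite lerBlDr -{1}(subrK y x) normcD.
rewrite -normc_norm lecR ler_norml dist andbT lerNl opprB.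
apply: le_trans (dist _ _) _.
by rewrite -lecR !normc_norm distrC.
Unshelve. all: by end_near. Qed.

Lemma real_complex_continuous : continuous (real_complex R : R -> C).
Proof.
move=> x; apply/cvgrPdist_lt => e e0.
(* Here [e] is a positive element of [R[i]], hence real. *)
have eE : e = (complex.Re e)%:C.
  by apply: conjc_id; apply/CrealP; rewrite gtr0_real.
have Re0 : 0 < complex.Re e by rewrite -ltcR -eE. near=> y.
rewrite -rmorphB eE /= -normc_norm.
have -> : Normc.normc ((x - y)%:C : C) = `|x - y| by rewrite /= expr0n addr0 sqrtr_sqr.
by rewrite eE ltcR /=; near: y; exists (complex.Re e).
Unshelve. all: by end_near. Qed.

Lemma sum_norm_continuous (X : topologicalType) n (f : X -> 'M[C]_n) (B : 'M[C]_n) :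
  continuous f -> continuous (fun x => sum_norm (f x - B)).
Proof.
move=> fc; rewrite /sum_norm.
have sum_c (F : 'I_n -> X -> R) :
    (forall i, continuous (F i)) -> continuous (fun x => \sum_i F i x).
  move=> Fc; rewrite -[fun _ => _]/(fun x => \sum_(i <- index_enum 'I_n) F i x).
  elim: (index_enum _) => [|i s IHs].
    rewrite (_ : (fun _ => _) = cst 0); first by move=> x; exact: cvg_cst.
    by apply/funext => x; rewrite big_nil.
  rewrite (_ : (fun _ => _) = F i \+ (fun x => \sum_(j <- s) F j x)).
    by move=> x; exact: cvgD (Fc i x) (IHs x).
  by apply/funext => x; rewrite big_cons.
apply: (sum_c) => i; apply: (sum_c) => j.
rewrite (_ : (fun _ => _) = (@Normc.normc R : C -> R) \o (fun x => f x i j - B i j)).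
  move=> x; apply: continuous_comp; last exact: normc_continuous.
  apply: (@cvgB C C); last exact: cvg_cst.
  exact: (continuous_comp (fc x) (coord_continuous (x := _))).
by apply/funext => x; rewrite /= !mxE.
Qed.

Lemma mx_continuous (X : topologicalType) n (f : X -> 'M[C]_n) :
  (forall i j, continuous (fun x => f x i j)) -> continuous f.
Proof.
move=> fc x A [P Pf PA].
have : \forall y \near x, forall i j, P i j (f y i j).
  apply: filter_forall => i; apply: filter_forall => j; exact: fc.
by apply: filterS => y Py; exact: PA.
Qed.
End MatrixNorm.

(** * Generic sequences of matrices *)

Section GenericSequence.
Variable R : realType.
Local Notation C := R[i].

(** [generic_perturbation] is applied recursively, at stage [i] to the list [Ls i] of the earlier
    matrices. *)
Lemma generic_sequence n (B : nat -> 'M[C]_n) (delta : nat -> R) :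
  (forall i, (B i)^t* = B i) -> (forall i, 0 < delta i) ->
  exists A : nat -> 'M[C]_n, forall i, [/\ (A i)^t* = A i,
    sum_norm (A i - B i) < delta i &
    forall (s : seq nat) (c : nat -> R), (size s <= 4)%N -> all (ltn^~ i) s ->
      almost_simple (A i + \sum_(j <- s) (c j)%:C *: A j)].
Proof.
move=> BB delta0.
(* The index type has one element more than the list; this extra index yields the default matrix 0
   and pads combinations of fewer than four terms. *)
have /choice[pick pickP] : forall Li : seq 'M[C]_n * nat, exists A : 'M[C]_n,
    {in Li.1, forall L, L^t* = L} -> [/\ A^t* = A, sum_norm (A - B Li.2) < delta Li.2 &
      forall (jj : {ffun 'I_4 -> 'I_(size Li.1).+1}) (c : 'I_4 -> R),
        almost_simple (A + \sum_a (c a)%:C *: Li.1`_(jj a))].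
  move=> [L i] /=; have [LL|] := pselect {in L, forall L, L^t* = L}; last first.
    by move=> Lbad; exists 0.
  have [|A AP] := @generic_perturbation _ n _
    (fun k : 'I_(size L).+1 => L`_k) _ _ _ (BB i) (delta0 i).
    move=> k; have [kL|kL] := ltnP k (size L); first by apply: LL; exact: mem_nth.
    by rewrite nth_default // trmx0 map_mx0.
  by exists A.
pose Ls := fix Ls i := if i is j.+1 then rcons (Ls j) (pick (Ls j, j)) else [::].
pose A i := pick (Ls i, i).
have LsE i : Ls i = mkseq A i.
  by elim: i => [//|i IHi]; rewrite /= mkseqS -IHi.
have AA i : {in Ls i, forall L, L^t* = L}.
  elim: i => [//|i IHi] L /=; rewrite mem_rcons inE => /orP[/eqP ->|/IHi//].
  by have [] := pickP (Ls i, i) IHi.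
exists A => i; have [AiA Ad good] := pickP (Ls i, i) (AA i); split=> // s c s4 si.
(* Beyond the end of [s], [nth] returns [i], the length of [Ls i], which selects the zero matrix. *)
pose jj := [ffun a : 'I_4 => inord (nth i s a) : 'I_(size (Ls i)).+1].
have := good jj (fun a => c (nth i s a)); congr (almost_simple (_ + _)).
have jjE (a : 'I_4) : (Ls i)`_(jj a) = if (a < size s)%N then A (nth i s a) else 0.
  rewrite /= ffunE LsE size_mkseq; case: ltnP => as_.
    have ai : (nth i s a < i)%N by move/allP: si; apply; exact: mem_nth.
    by rewrite inordK ?nth_mkseq // ltnW.
  by rewrite (nth_default i as_) inordK // nth_default // size_mkseq.
under eq_bigr => a _ do rewrite jjE.
rewrite (big_nth i) big_mkord.
rewrite (big_ord_widen _ (fun j => (c (nth i s j))%:C *: A (nth i s j)) s4).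
rewrite [RHS]big_mkcond; apply: eq_bigr => a _ /=.
by case: ifP => // _; rewrite scaler0.
Qed.

Lemma almost_simpleZ n (a : R) (A : 'M[C]_n) : a != 0 ->
  almost_simple A -> almost_simple (a%:C *: A).
Proof.
move=> a0 [s [s_uniq sn sA]]; have a0C : a%:C != 0 :> C by rewrite fmorph_eq0.
exists [seq a%:C * l | l <- s]; split; rewrite ?size_map //.
  by rewrite map_inj_uniq //; exact: mulfI.
apply/allP => _ /mapP[l /(allP sA) /eigenvalueP[v vA v0] ->].
by apply/eigenvalueP; exists v => //; rewrite -scalemxAr vA scalerA.
Qed.

(** At most five weights are nonzero. Dividing by the one with the largest index [i] leaves [A i]
    plus a combination of at most four earlier matrices. *)
Lemma almost_simple_combination n (A : nat -> 'M[C]_n) (p : nat -> R) K :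
  (forall i (s : seq nat) (c : nat -> R), (size s <= 4)%N -> all (ltn^~ i) s ->
      almost_simple (A i + \sum_(j <- s) (c j)%:C *: A j)) ->
  ([set i | p i != 0] #<= `I_5)%card -> \sum_(i < K) p i != 0 ->
  almost_simple (\sum_(i < K) (p i)%:C *: A i).
Proof.
move=> good p5 p_neq0.
pose s := [seq i <- iota 0 K | p i != 0].
have s5 : (size s <= 5)%N.
  rewrite -card_le_II; apply: card_le_trans p5.
  have : ([set nth 0%N s k | k in `I_(size s)] #= `I_(size s))%card.
    apply: inj_card_eq => k l; rewrite !inE => ks ls /eqP.
    by rewrite nth_uniq ?filter_uniq ?iota_uniq // => /eqP.
  rewrite card_eq_sym => /card_eqPle[/card_le_trans + _]; apply.
  apply: subset_card_le => _ [k /= ks <-].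
  by have := mem_nth 0%N ks; rewrite mem_filter => /andP[].
have -> : \sum_(i < K) (p i)%:C *: A i = \sum_(i <- s) (p i)%:C *: A i.
  rewrite big_filter -(big_mkord xpredT (fun i => (p i)%:C *: A i)) /index_iota subn0.
  rewrite [RHS]big_mkcond; apply: eq_bigr => i _.
  by case: eqVneq => [->|]; rewrite ?scale0r.
have s_nil : s != [::].
  apply: contra_neq p_neq0 => s0; rewrite big1 // => i _; apply/eqP/negPn/negP => pi.
  by have : (i : nat) \in s by [rewrite mem_filter pi mem_iota add0n ltn_ord]; rewrite s0.
have s_sorted : sorted ltn s.
  by apply: (sorted_filter ltn_trans); exact: iota_ltn_sorted.
have pS i : i \in s -> p i != 0 by rewrite mem_filter => /andP[].
case/lastP: s s5 s_nil s_sorted pS => [//|s i] s5 _ s_sorted pS.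
have pi : p i != 0 by apply: pS; rewrite mem_rcons mem_head.
have -> : \sum_(j <- rcons s i) (p j)%:C *: A j =
    (p i)%:C *: (A i + \sum_(j <- s) (p j / p i)%:C *: A j).
  rewrite -cats1 big_cat big_seq1 addrC scalerDr scaler_sumr; congr (_ + _).
  apply: eq_bigr => j _; rewrite scalerA -rmorphM; congr (_%:C *: _).
  by field.
apply: almost_simpleZ => //; apply: good; first by rewrite size_rcons in s5.
by move: s_sorted; rewrite (sorted_pairwise ltn_trans) pairwise_rcons => /andP[].
Qed.
End GenericSequence.

(** * A countable dense family of hermitian matrices *)

Section RationalMatrices.
Variable R : realType.
Local Notation C := R[i].

(** Countability of these matrices lets the cover of [X] be indexed by [nat]. *)
Definition rat_herm n (Y : 'M[rat]_n) : 'M[C]_n :=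
  herm_of (map_mx (fun q => (ratr q : R)%:C) Y).

Lemma rat_herm_herm n (Y : 'M[rat]_n) : (rat_herm Y)^t* = rat_herm Y.
Proof. by apply: herm_of_herm => i j; rewrite mxE conjc_real. Qed.

Lemma rat_herm_dense n (A : 'M[C]_n) (delta : R) : A^t* = A -> 0 < delta ->
  exists Y, sum_norm (A - rat_herm Y) < delta.
Proof.
move=> AA delta0; pose e := delta / ((n * n)%:R * 2 + 1).
have d_gt0 : 0 < (n * n)%:R * 2 + 1 :> R by rewrite ltr_wpDl ?mulr_ge0 ?ler0n.
have e0 : 0 < e by rewrite divr_gt0.
have /choice[q qP] : forall ij : 'I_n * 'I_n, exists q : rat,
    `|complex.Re (coord_of A ij.1 ij.2) - ratr q| <= e.
  move=> ij; set x := complex.Re _.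
  have [|q] := @rat_in_itvoo R (x - e) (x + e); first by rewrite ltrD2l gtrN.
  rewrite in_itv /= => /andP[xq qx]; exists q.
  by rewrite ler_norml; apply/andP; split; lra.
exists (\matrix_(i, j) q (i, j)).
have -> : A - rat_herm (\matrix_(i, j) q (i, j)) =
    herm_of (coord_of A - map_mx (fun q => (ratr q : R)%:C) (\matrix_(i, j) q (i, j))).
  by rewrite -[in LHS](coord_ofK A); apply/matrixP => i j; rewrite !mxE; ring.
apply: (@le_lt_trans _ _ ((n * n)%:R * (2 * e))).
  apply: sum_norm_herm_of => i j; rewrite mxE.
  have := qP (i, j); have := conjc_id (coord_of_real i j AA) => /=.
  move: (coord_of A i j) => x -> qx; rewrite !mxE -rmorphB -normc_norm lecR.
  by rewrite /= expr0n addr0 sqrtr_sqr.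
have -> : delta = e * ((n * n)%:R * 2 + 1) by rewrite divfK // gt_eqF.
lra.
Qed.
End RationalMatrices.

Theorem theorem5p4 (R : realType) (X : topologicalType)
    (normalX : normal_space X) (dimX : covering_dim_le X 4)
    (n : nat) (n_ge1 : (1 <= n)%N)
    (f : X -> 'M[R[i]]_n) (f_sa : forall x, f x \is hermsymmx)
    (f_cont : continuous f)
    (eps : X -> R) (eps_gt0 : forall x, 0 < eps x) (eps_cont : continuous eps) :
  exists g : X -> 'M[R[i]]_n,
    [/\ forall x, g x \is hermsymmx,
        continuous g &
        forall x, op_norm (f x - g x) < eps x /\
          exists s : seq R[i],
            [/\ uniq s, (n - 1 <= size s)%N & all (eigenvalue (g x)) s]].
Proof.
have fx_sa x : (f x)^t* = f x by exact/hermP.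
(* Each code [i] stands for a rational matrix and a precision [k]; other numbers get a default pair,
   which is as good as any. *)
pose center (i : nat) : 'M[rat]_n * nat := odflt (0, 0%N) (unpickle i).
pose B i : 'M[R[i]]_n := rat_herm R (center i).1.
pose delta i : R := (center i).2.+1%:R^-1.
have delta0 i : 0 < delta i by rewrite invr_gt0.
have [A AP] := generic_sequence (fun i => rat_herm_herm R (center i).1) delta0.
(* Positivity of [h i x] says that [f x] is within [delta i] of [B i] and that
   [2 * delta i < eps x]. *)
pose h i x : R := Num.min (delta i - sum_norm (f x - B i)) (eps x - 2 * delta i).
have h_cont i : continuous (h i).
  move=> x; apply: (@continuous_min R X (fun x => delta i - sum_norm (f x - B i))
    (fun x => eps x - 2 * delta i)).
    by apply: cvgB; [exact: cvg_cst|exact: sum_norm_continuous].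
  by apply: cvgB; [exact: eps_cont|exact: cvg_cst].
have h_pos x : exists i, 0 < h i x.
  have : 0 < eps x / 2 by rewrite divr_gt0.
  move=> /ltr_add_invr[k]; rewrite add0r => keps.
  have [|Y Yf] := rat_herm_dense (fx_sa x) (_ : 0 < k.+1%:R^-1 :> R).
    by rewrite invr_gt0.
  exists (pickle (Y, k)); rewrite /h /B /delta /center pickleK /=.
  by rewrite lt_min !subr_gt0 Yf /= mulrC -ltr_pdivlMr.
have [U [Ucov Uoff Uh]] := locally_finite_refinement h_cont h_pos.
have [W [Wcov WU W5]] := covering_dim_shrink dimX Ucov.
have Woff : eventually_off W.
  move=> x; have [K offK] := Uoff x; exists K.
  by apply: filterS offK => y offy i /offy Uiy /WU.
have [p [K [p_cont p0 pW pK psum]]] := partition_of_unity R normalX Wcov Woff.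
(* Both [f x] and [A i] are within [delta i] of [B i], and [2 * delta i < eps x]. *)
have close i x : p i x != 0 -> sum_norm (f x - A i) < eps x.
  move=> /pW/WU/Uh; rewrite lt_min !subr_gt0 => /andP[fB deltae].
  have [_ AB _] := AP i.
  have -> : f x - A i = (f x - B i) - (A i - B i) by rewrite opprB addrA subrK.
  apply: le_lt_trans (sum_normD _ _) _; rewrite sum_normN; lra.
pose g x : 'M[R[i]]_n := \sum_(i < K x) (p i x)%:C *: A i.
have g_sa x : (g x)^t* = g x.
  rewrite /g linear_sum map_mx_sum; apply: eq_bigr => i _.
  by rewrite conj_mxZ; case: (AP i) => ->.
exists g; split=> [x||x].
- exact/hermP.
(* Near [x] the cutoff [K y] can be replaced by the constant [K x]. *)
- apply: near_continuous => x; exists (fun y => \sum_(i < K x) (p i y)%:C *: A i).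
    apply: mx_continuous => a b.
    rewrite (_ : (fun _ => _) = (fun y => \sum_(i < K x) (p i y)%:C * A i a b)).
      apply: (@continuous_finite_sum X R[i] R[i]
        (fun i y => (p i y)%:C * A i a b)) => i y.
      apply: (@cvgM R[i]); last exact: cvg_cst.
      apply: (continuous_comp (p_cont i y)); exact: real_complex_continuous.
    by apply/funext => y; rewrite summxE; apply: eq_bigr => i _; rewrite mxE.
  apply: filterS (pK x) => y pKy.
  apply: (@sum_off _ (fun i => (p i y)%:C *: A i)) => i Ki.
    by rewrite (nbhs_singleton (pK y)) ?scale0r.
  by rewrite pKy ?scale0r.
- have psum_neq0 : \sum_(i < K x) p i x != 0 by rewrite psum oner_eq0.
  split; last first.
    apply: (@almost_simple_combination R n A (p ^~ x) (K x) _ _ psum_neq0).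
      by move=> i; case: (AP i).
    by apply: card_le_trans (W5 x); apply: subset_card_le => i; exact: pW.
  apply: le_lt_trans (op_norm_le _) _.
  have -> : f x - g x = \sum_(i < K x) (p i x)%:C *: (f x - A i).
    under eq_bigr do rewrite scalerBr.
    rewrite sumrB -scaler_suml -rmorph_sum psum /= rmorph1 scale1r //.
  apply: le_lt_trans (sum_norm_sum _ _) _.
  have [i pi] : exists i : 'I_(K x), p i x != 0.
    apply: contra_notP (negP psum_neq0); move=> /forallNP pz; apply/eqP.
    by rewrite big1 // => i _; apply: contrapT => /eqP; exact: pz.
  (* As the weights sum to 1, [eps x] minus the bound is a sum of terms
     [p i x * (eps x - sum_norm (f x - A i))], all nonnegative and one positive. *)
  rewrite -subr_gt0 -[X in X - _]mul1r -(psum x) big_distrl -sumrB (bigD1 i) //=.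
  apply: ltr_pwDl.
    rewrite sum_normZ // -mulrBr mulr_gt0 ?subr_gt0 ?close //.
    by rewrite lt_neqAle eq_sym pi p0.
  apply: sumr_ge0 => j _; rewrite sum_normZ // -mulrBr.
  have [->|pj] := eqVneq (p j x) 0; first by rewrite mul0r.
  by rewrite mulr_ge0 // subr_ge0 ltW // close.
Qed.
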